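(* Let $n,r\ge1$ be integers and let $$v_{n,r}=2\min\left(\max\left(r\,\mathbb{E}K_{n,r},(r+1)\mathbb{E}K_{n,r+1}\right),\ \mathbb{E}K_{n,\overline{r}}\right).$$ Then, for all $s\ge0$, $$\mathbb{P}\left\{|K_{n,r}-\mathbb{E}K_{n,r}|\ge\sqrt{4v_{n,r}s}+\frac{2s}{3}\right\}\le 4e^{-s}.$$
   Context: Let $(p_j)_{j\ge1}$ be a probability mass function on the positive integers, and let $U_1,\dots,U_n$ be i.i.d. with $\mathbb{P}(U_i=j)=p_j$. Put $X_{n,j}=\sum_{i=1}^n \mathbb{I}_{\{U_i=j\}}$, $K_{n,r}=\sum_{j\ge1}\mathbb{I}_{\{X_{n,j}=r\}}$ (number of symbols occurring exactly $r$ times) and $K_{n,\overline{r}}=\sum_{j\ge1}\mathbb{I}_{\{X_{n,j}\ge r\}}$ (number of symbols occurring at least $r$ times). *)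

(* Defs.v *)
From HB Require Import structures.
From mathcomp Require Import all_boot all_order all_algebra.
From mathcomp Require Import all_classical all_reals all_analysis.

Set Implicit Arguments.
Unset Strict Implicit.
Unset Printing Implicit Defensive.

Import Order.TTheory GRing.Theory Num.Theory.
Import numFieldNormedType.Exports.

Local Open Scope classical_set_scope.
Local Open Scope ring_scope.

(* The positive integers are the [j : nat] with [1 <= j]; the value [p 0] is
   never used. *)
Definition is_pmf_pos (R : realType) (p : nat -> R) : Prop :=
  (forall j, (1 <= j)%N -> 0 <= p j) /\
  (\sum_(1 <= j <oo) (p j)%:E = 1)%E.

(* Together with [is_pmf_pos p] this forces [P (U @^-1` [set 0%N]) = 0]. *)
Definition has_pmf_pos d (T : measurableType d) (R : realType)
    (P : probability T R) (U : {RV P >-> nat}) (p : nat -> R) : Prop :=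
  forall j, (1 <= j)%N -> P (U @^-1` [set j]) = (p j)%:E.

Definition mutually_independent d d' (T : measurableType d)
    (T' : measurableType d') (R : realType) (P : probability T R)
    (I : finType) (U : I -> {RV P >-> T'}) : Prop :=
  forall (J : {set I}) (A : I -> set T'),
    (forall i, i \in J -> measurable (A i)) ->
    (P (\bigcap_(i in [set` J]) (U i @^-1` A i)) =
     \prod_(i in J) P (U i @^-1` A i))%E.

Section occupancy.
Context d (T : measurableType d) (R : realType) (P : probability T R).
Context (n : nat) (U : 'I_n -> {RV P >-> nat}).

Definition occ (j : nat) (w : T) : nat := (\sum_(i < n) (U i w == j))%N.

(* For [1 <= r] at most [n] terms of the two series below are nonzero, so
   [fine] loses nothing; at [r = 0] the sums are infinite and [fine] is [0]. *)
Definition occ_eq (r : nat) (w : T) : R :=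
  fine (\sum_(1 <= j <oo) ((occ j w == r)%:R : R)%:E)%E.

Definition occ_ge (r : nat) (w : T) : R :=
  fine (\sum_(1 <= j <oo) ((r <= occ j w)%N%:R : R)%:E)%E.

Definition var_proxy (r : nat) : R :=
  2 * Num.min
        (Num.max (r%:R * fine 'E_P[occ_eq r])
                 (r.+1%:R * fine 'E_P[occ_eq r.+1]))
        (fine 'E_P[occ_ge r]).

End occupancy.

(* Main.v *)
Require Import Defs.
From HB Require Import structures.
From mathcomp Require Import all_boot all_order all_algebra.
From mathcomp Require Import all_classical all_reals all_analysis.
From mathcomp Require Import measurable_realfun ring lra.

(* [K_{n,r}] is the difference of the counts [K_{n,>=r}] and [K_{n,>=r+1}], so
   it suffices that each of them satisfies Bernstein's inequality with variance
   factor [v/2]. The loads of the urns are negatively associated, hence the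
   moment generating function of a centered count [K_{n,>=r}] is at most the
   product of those of its centered Bernoulli indicators [1{X_j >= r}], each of
   which Bennett's argument bounds by [exp (Var * (e^x - 1 - x))]. Finally the
   variance of such an indicator is at most [P(X_j >= r)] and also at most
   [r P(X_j = r)]; summing over the urns gives [E K_{n,>=r}] and
   [r E K_{n,r}]. Negative association is proved for finitely many urns, the
   general case being the limit of the truncations to symbols [<= N]. *)

Import Order.TTheory GRing.Theory Num.Theory.
Import numFieldNormedType.Exports.

Set Implicit Arguments.
Unset Strict Implicit.

Local Open Scope classical_set_scope.
Local Open Scope ring_scope.

(** * Bennett's function, the log moment generating function of a centered Poisson variable of mean
    1 *)

Definition bennett_fun (R : realType) (x : R) : R := expR x - 1 - x.

Lemma ge0_from_derive (R : realType) (f f' : R -> R) :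
  (forall x, is_derive x (1 : R) f (f' x)) -> 0 <= f 0 ->
  (forall x, 0 <= x -> 0 <= f' x) -> forall x, 0 <= x -> 0 <= f x.
Proof.
move=> df f0 f'0 x x0; apply: (le_trans f0).
have cf : {within `[0, x], continuous f}.
  apply: continuous_subspaceT => y.
  by apply/differentiable_continuous/derivable1_diffP; case: (df y).
have [c cin fc] := @MVT_segment R f f' 0 x x0 (fun y _ => df y) cf.
rewrite -subr_ge0 fc subr0 mulr_ge0// f'0//.
by move: cin; rewrite in_itv/= => /andP[].
Qed.

(** Both sides and their first derivatives in [x] agree at 0, and the second derivative of the
    difference is [y ^+ 2 * (expR x - expR (x * y))], which is nonnegative since [x * y <= x]. *)
Lemma bennett_fun_scale (R : realType) (y : R) : `|y| <= 1 ->
  forall x, 0 <= x -> bennett_fun (x * y) <= y ^+ 2 * bennett_fun x.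
Proof.
move=> y1 x x0; rewrite -subr_ge0 /bennett_fun.
pose f'' (x : R) := y ^+ 2 * (expR x - expR (x * y)).
pose f' (x : R) := y ^+ 2 * (expR x - 1) - y * (expR (x * y) - 1).
pose f (x : R) := y ^+ 2 * (expR x - 1 - x) - (expR (x * y) - 1 - x * y).
apply: (@ge0_from_derive _ f f') => //; first 1 last.
- by rewrite /f mul0r expR0 !subrr mulr0 subr0.
- apply: (@ge0_from_derive _ _ f'').
  + move=> z; rewrite /f' /f''; apply: is_derive_eq.
    rewrite /GRing.scale/=; ring.
  + by rewrite /f' mul0r expR0 !subrr !mulr0 subr0.
  + move=> z z0; rewrite mulr_ge0 ?sqr_ge0// subr_ge0 ler_expR.
    rewrite -[leRHS]mulr1 ler_wpM2l//.
    by move: y1; rewrite ler_norml => /andP[].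
- move=> z; rewrite /f' /f; apply: is_derive_eq.
  rewrite /GRing.scale/=; ring.
Qed.

(** Two differentiations reduce this to [1 - x <= expR (- x)]. Keeping the factor [1 - x / 3] on the
    left avoids dividing by it, hence any condition [x < 3]. *)
Lemma bennett_fun_le_bernstein (R : realType) (x : R) : 0 <= x ->
  (1 - x / 3) * bennett_fun x <= x ^+ 2 / 2.
Proof.
move=> x0; rewrite -subr_ge0 /bennett_fun.
pose f'' (x : R) := (1 - expR x * (1 - x)) / 3.
pose f' (x : R) := x + (expR x - 1 - x) / 3 - (1 - x / 3) * (expR x - 1).
pose f (x : R) := x ^+ 2 / 2 - (1 - x / 3) * (expR x - 1 - x).
apply: (@ge0_from_derive _ f f') => //; first 1 last.
- by rewrite /f expR0 expr0n/=; lra.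
- apply: (@ge0_from_derive _ _ f'').
  + move=> z; rewrite /f' /f''; apply: is_derive_eq.
    by rewrite /GRing.scale/=; field.
  + by rewrite /f' expR0; lra.
  + move=> z z0; rewrite /f'' divr_ge0// subr_ge0 mulrC.
    rewrite -ler_pdivlMr ?expR_gt0//.
    by rewrite div1r -expRN; apply: expR_ge1Dx.
- move=> z; rewrite /f' /f; apply: is_derive_eq.
  by rewrite /GRing.scale/=; field.
Qed.

Lemma bennett_fun_ge0 (R : realType) (x : R) : 0 <= bennett_fun x.
Proof. by rewrite /bennett_fun -addrA -opprD subr_ge0 expR_ge1Dx. Qed.

(** In [expR u = 1 + u + bennett_fun u] the linear terms average to 0, and [bennett_fun_scale]
    leaves the weight [(1 - q) * q ^+ 2 + q * (1 - q) ^+ 2 = q * (1 - q)]. The sign [y] treats the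
    upper and lower tails at once. *)
Lemma centered_bernoulli_mgf_le (R : realType) (q x y : R) : 0 <= q <= 1 ->
  0 <= x -> `|y| = 1 ->
  (1 - q) * expR (x * (- (y * q))) + q * expR (x * (y * (1 - q))) <=
  expR (q * (1 - q) * bennett_fun x).
Proof.
move=> /andP[q0 q1] x0 y1; apply: le_trans (expR_ge1Dx _).
have y2 : y ^+ 2 = 1 by rewrite -(real_normK (num_real y)) y1 expr1n.
have h1 : `|- (y * q)| <= 1 by rewrite normrN normrM y1 mul1r ger0_norm.
have h2 : `|y * (1 - q)| <= 1.
  by rewrite normrM y1 mul1r ger0_norm ?subr_ge0// lerBlDl lerDr.
move: (bennett_fun_scale h1 x0) (bennett_fun_scale h2 x0).
rewrite sqrrN !exprMn y2 !mul1r {1 3}/bennett_fun.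
set A := expR _; set B := expR _; set phi := bennett_fun x => hA hB.
have := ler_wpM2l (_ : 0 <= 1 - q) hA; rewrite subr_ge0 => /(_ q1).
by have := ler_wpM2l q0 hB; lra.
Qed.

(** * Independent balls in finitely many urns: negative association and variance bounds *)

Section finite_urns.
Context (R : realType) (K : finType).

Definition load n (w : {ffun 'I_n -> K}) (j : K) : nat :=
  (\sum_(i < n) (w i == j))%N.

Definition urn_mean n (q : 'I_n -> K -> R) (F : {ffun 'I_n -> K} -> R) : R :=
  \sum_(w : {ffun 'I_n -> K}) (\prod_i q i (w i)) * F w.

Definition stochastic n (q : 'I_n -> K -> R) : Prop :=
  forall i, (forall k, 0 <= q i k) /\ \sum_k q i k = 1.

Definition ffun_cons n (k : K) (w : {ffun 'I_n -> K}) : {ffun 'I_n.+1 -> K} :=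
  [ffun i => oapp w k (unlift ord0 i)].

Lemma load_cons n k (w : {ffun 'I_n -> K}) j :
  load (ffun_cons k w) j = ((k == j) + load w j)%N.
Proof.
rewrite /load big_ord_recl ffunE unlift_none/=; congr addn.
by apply: eq_bigr => i _; rewrite ffunE liftK.
Qed.

(** Conditioning on the urn of the first ball; the inductions on the number of balls rest on it. *)
Lemma urn_meanS n (q : 'I_n.+1 -> K -> R) F : urn_mean q F =
  \sum_k q ord0 k *
    urn_mean (fun i => q (lift ord0 i)) (fun w => F (ffun_cons k w)).
Proof.
pose h (p : K * {ffun 'I_n -> K}) := ffun_cons p.1 p.2.
rewrite /urn_mean (reindex h) /=; last first.
  exists (fun w : {ffun 'I_n.+1 -> K} => (w ord0, [ffun i => w (lift ord0 i)])).
    move=> [k w] _; rewrite /h /= ffunE unlift_none/=; congr pair.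
    by apply/ffunP => i; rewrite !ffunE liftK.
  move=> w _; apply/ffunP => i; rewrite ffunE /=.
  by case: unliftP => [j|] -> //=; rewrite ffunE.
rewrite -(pair_bigA _ (fun k w =>
  (\prod_i q i (ffun_cons k w i)) * F (ffun_cons k w)))/=.
apply: eq_bigr => k _; rewrite big_distrr/=; apply: eq_bigr => w _.
rewrite big_ord_recl ffunE unlift_none/= -mulrA; congr (_ * (_ * _)).
by apply: eq_bigr => i _; rewrite ffunE liftK.
Qed.

Lemma urn_mean0 (q : 'I_0 -> K -> R) F w0 : urn_mean q F = F w0.
Proof.
have E (w : {ffun 'I_0 -> K}) : w = w0 by apply/ffunP => -[].
rewrite /urn_mean (eq_bigl (pred1 w0)) ?big_pred1_eq ?big_ord0 ?mul1r// => w.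
by rewrite /= [w]E eqxx.
Qed.

Let w0 : {ffun 'I_0 -> K} :=
  [ffun i : 'I_0 => False_rect K (notF (ltn_ord i))].

Lemma stochasticS n (q : 'I_n.+1 -> K -> R) : stochastic q ->
  stochastic (fun i => q (lift ord0 i)).
Proof. by move=> h i; apply: h. Qed.

Lemma stochastic_ge0 n (q : 'I_n -> K -> R) i k : stochastic q -> 0 <= q i k.
Proof. by move=> /(_ i)[]. Qed.

Lemma stochastic_le1 n (q : 'I_n -> K -> R) i k : stochastic q -> q i k <= 1.
Proof.
move=> /(_ i)[q0 <-]; rewrite (bigD1 k)//= lerDl.
by apply: sumr_ge0 => ? _; exact: q0.
Qed.

Lemma le_urn_mean n (q : 'I_n -> K -> R) F G : stochastic q ->
  (forall w, F w <= G w) -> urn_mean q F <= urn_mean q G.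
Proof.
move=> hq FG; apply: ler_sum => w _; apply: ler_wpM2l => //.
by apply: prodr_ge0 => i _; exact: stochastic_ge0.
Qed.

Lemma urn_meanZ n (q : 'I_n -> K -> R) c F :
  urn_mean q (fun w => c * F w) = c * urn_mean q F.
Proof. by rewrite /urn_mean mulr_sumr; apply: eq_bigr => w _; ring. Qed.

Lemma urn_meanD n (q : 'I_n -> K -> R) F G :
  urn_mean q (fun w => F w + G w) = urn_mean q F + urn_mean q G.
Proof. by rewrite /urn_mean -big_split/=; apply: eq_bigr => w _; ring. Qed.

Lemma urn_mean_sum n (q : 'I_n -> K -> R) (D : pred K) F :
  urn_mean q (fun w => \sum_(j | D j) F j w) =
  \sum_(j | D j) urn_mean q (F j).
Proof.
rewrite /urn_mean exchange_big/=; apply: eq_bigr => w _.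
by rewrite mulr_sumr.
Qed.

Lemma urn_mean_cst n (q : 'I_n -> K -> R) c : stochastic q ->
  urn_mean q (fun=> c) = c.
Proof.
elim: n q => [|n IH] q hq; first by rewrite (urn_mean0 _ _ w0).
rewrite urn_meanS; under eq_bigr do rewrite (IH _ (stochasticS hq)).
by rewrite -mulr_suml; have [_ ->] := hq ord0; rewrite mul1r.
Qed.

(** The load of urn [j] depends on the first ball only through whether that ball hits [j], so its
    law is a mixture of two laws with weights [1 - q ord0 j] and [q ord0 j]. *)
Lemma urn_mean_loadS n (q : 'I_n.+1 -> K -> R) (g : nat -> R) j :
  stochastic q ->
  let q' := fun i => q (lift ord0 i) in
  let a := urn_mean q' (fun w => g (load w j)) in
  let b := urn_mean q' (fun w => g (load w j).+1) in
  urn_mean q (fun w => g (load w j)) = a + q ord0 j * (b - a).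
Proof.
move=> hq q' a b; rewrite urn_meanS (bigD1 j)//=.
under eq_bigr => k kj.
  rewrite (_ : urn_mean _ _ = a); first over.
  apply: eq_bigr => w _; rewrite load_cons (negbTE kj)//=.
rewrite -mulr_suml.
have [_] := hq ord0; rewrite (bigD1 j)//= => /eqP.
rewrite eq_sym addrC -subr_eq eq_sym => /eqP ->.
rewrite (_ : urn_mean _ _ = b); first by ring.
by apply: eq_bigr => w _; rewrite load_cons eqxx.
Qed.

(** A Weierstrass product inequality: when all increments have the same sign, a product dominates
    its first-order expansion, because the terms dropped at each induction step are nonnegative. *)
Lemma weierstrass_prod_ge (s : seq K) (a d : K -> R) : uniq s ->
  (forall j, 0 <= a j) -> (forall j, 0 <= a j + d j) ->
  (forall j, 0 <= d j) \/ (forall j, d j <= 0) ->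
  \prod_(j <- s) a j + \sum_(k <- s) d k * \prod_(j <- s | j != k) a j <=
  \prod_(j <- s) (a j + d j).
Proof.
move=> us a0 ad0 dd.
elim: s us => [|x s IH] /=; first by rewrite !big_nil addr0.
move=> /andP[xs us]; rewrite !big_cons eqxx/=.
have -> : \prod_(j <- s | j != x) a j = \prod_(j <- s) a j.
  rewrite big_seq_cond [RHS]big_seq; apply: eq_bigl => j.
  by case: (boolP (j \in s)) => //= js; apply: contraNneq xs => <-.
rewrite [X in _ + (_ + X)](_ : _ =
    a x * \sum_(k <- s) d k * \prod_(j <- s | j != k) a j); last first.
  rewrite mulr_sumr big_seq [RHS]big_seq; apply: eq_bigr => k ks.
  rewrite big_cons ifT; first by ring.
  by apply: contraNneq xs => ->.
move: {IH}(IH us); set S := \sum_(k <- s) _; set A := \prod_(j <- s) a j.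
set L := \prod_(j <- s) _ => IH.
(* [L - A] has the common sign of the increments, since [L] is [A] with every factor moved in that
   direction. *)
have dL : 0 <= d x * (L - A).
  case: dd => dd.
    rewrite mulr_ge0// subr_ge0; apply: ler_prod => j _.
    by rewrite a0 lerDl dd.
  rewrite mulr_le0// subr_le0; apply: ler_prod => j _.
  by rewrite ad0 gerDl dd.
have aL := mulr_ge0 (a0 x) (_ : 0 <= L - (A + S)).
by move: aL; rewrite subr_ge0 => /(_ IH); nra.
Qed.

(* Negative association of the loads, for functions of single loads. By
   induction on the number of balls: conditionally on the urn [k] of the first
   ball, only the [k]-th factor changes, from [a k] to [b k], and the mixture
   over [k] is the first-order part of the product of the mixtures. *)
Lemma urn_mean_prod_le n (q : 'I_n -> K -> R) (f : K -> nat -> R) :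
  stochastic q -> (forall j m, 0 <= f j m) ->
  (forall j m, f j m <= f j m.+1) \/ (forall j m, f j m.+1 <= f j m) ->
  urn_mean q (fun w => \prod_j f j (load w j)) <=
  \prod_j urn_mean q (fun w => f j (load w j)).
Proof.
elim: n q f => [|n IH] q f hq f0 fm.
  rewrite (urn_mean0 _ _ w0).
  by apply: ler_prod => j _; rewrite f0/= (urn_mean0 _ _ w0).
have hq' := stochasticS hq; set q' := fun i => q (lift ord0 i).
pose a j := urn_mean q' (fun w => f j (load w j)).
pose b j := urn_mean q' (fun w => f j (load w j).+1).
have um0 F : (forall w, 0 <= F w) -> 0 <= urn_mean q' F.
  move=> F0; rewrite -(urn_mean_cst 0 hq').
  exact: le_urn_mean.
have a0 j : 0 <= a j by exact: um0.
have b0 j : 0 <= b j by exact: um0.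
under [leRHS]eq_bigr do rewrite urn_mean_loadS//.
rewrite -/q'.
apply: (@le_trans _ _
  (\sum_k q ord0 k * \prod_j (if j == k then b j else a j))).
  rewrite urn_meanS; apply: ler_sum => k _; apply: ler_wpM2l.
    exact: stochastic_ge0.
  under [X in urn_mean _ X]eq_fun do under eq_bigr do rewrite load_cons.
  apply: le_trans (IH _ (fun j m => f j ((k == j) + m)%N) hq' _ _) _ => //.
    by case: fm => fm; [left|right] => j m; rewrite addnS.
  apply: ler_prod => j _; rewrite um0//= eq_sym.
  by case: eqP.
apply: le_trans (@weierstrass_prod_ge (index_enum K) a
   (fun j => q ord0 j * (b j - a j)) _ _ _ _) => //.
- have bD k : \prod_j (if j == k then b j else a j) =
      b k * \prod_(j | j != k) a j.
    rewrite (bigD1 k)//= eqxx; congr (_ * _).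
    by apply: eq_bigr => j /negbTE ->.
  have aD k : \prod_j a j = a k * \prod_(j | j != k) a j by rewrite (bigD1 k).
  have [_ q1] := hq ord0.
  have -> : \prod_j a j = \sum_k q ord0 k * \prod_j a j.
    by rewrite -mulr_suml q1 mul1r.
  rewrite -big_split/=.
  by apply: ler_sum => k _; rewrite bD (aD k); lra.
- exact: index_enum_uniq.
- move=> j; have := stochastic_ge0 ord0 j hq.
  have := stochastic_le1 ord0 j hq.
  by have := a0 j; have := b0 j; nra.
- by case: fm => fm; [left|right] => j;
    rewrite ?mulr_ge0 ?mulr_ge0_le0 ?subr_ge0 ?subr_le0//;
    solve [exact: stochastic_ge0 | exact: le_urn_mean].
Qed.

Definition tail_prob n (q : 'I_n -> K -> R) r j : R :=
  urn_mean q (fun w => (r <= load w j)%N%:R).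

Definition point_prob n (q : 'I_n -> K -> R) r j : R :=
  urn_mean q (fun w => (load w j == r)%:R).

Lemma tail_prob01 n (q : 'I_n -> K -> R) r j : stochastic q ->
  0 <= tail_prob q r j <= 1.
Proof.
move=> hq; rewrite -{1}(urn_mean_cst 0 hq) -(urn_mean_cst 1 hq).
by apply/andP; split; apply: le_urn_mean => // w; case: leq.
Qed.

(* The variance of the indicator is that of a mixture over the first ball; the
   extra term [p (1 - p) (G - F) ^ 2] is absorbed since [G - F] is a
   probability. *)
Lemma tail_prob_var_le n (q : 'I_n -> K -> R) r j : stochastic q ->
  tail_prob q r j * (1 - tail_prob q r j) <= r%:R * point_prob q r j.
Proof.
have t0 m (q' : 'I_m -> K -> R) : stochastic q' -> tail_prob q' 0 j = 1.
  exact: urn_mean_cst.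
elim: n q r => [|n IH] q r hq.
  case: r => [|r]; first by rewrite t0// subrr mulr0 mul0r.
  rewrite /tail_prob /point_prob !(urn_mean0 _ _ w0).
  by rewrite /load big_ord0/= mul0r mulr0.
case: r => [|r]; first by rewrite t0// subrr mulr0 mul0r.
have hq' := stochasticS hq; set q' := fun i => q (lift ord0 i) in hq'.
rewrite {1 2}/tail_prob /point_prob.
rewrite (urn_mean_loadS (fun m => (r < m)%N%:R) _ hq).
rewrite (urn_mean_loadS (fun m => (m == r.+1)%:R) _ hq)/=.
rewrite -/q'.
pose F := tail_prob q' r.+1 j; pose G := tail_prob q' r j.
pose b := point_prob q' r j; pose b' := point_prob q' r.+1 j.
rewrite -[X in X + _ * (_ - _)]/F.
have GF : G = F + b.
  rewrite /G /F /b -urn_meanD; apply: eq_bigr => w _; congr (_ * _).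
  by rewrite leq_eqVlt eq_sym; case: ltngtP; rewrite //= ?addr0 ?add0r.
have h1 := IH _ r.+1 hq'; have h2 := IH _ r hq'.
have /andP[G0 G1] := tail_prob01 r j hq'.
have /andP[F0 F1] := tail_prob01 r.+1 j hq'.
have p0 := stochastic_ge0 ord0 j hq.
have p1 := stochastic_le1 ord0 j hq.
have b0 : 0 <= b.
  by rewrite -(urn_mean_cst 0 hq'); apply: le_urn_mean => // w; case: eqP.
rewrite -/F -/G -/b -/b' in h1 h2 G0 G1 F0 F1 *.
set p := q ord0 j in p0 p1 *.
have -> : urn_mean q' (fun w => (r < (load w j).+1)%N%:R) = G by [].
have -> : urn_mean q' (fun w => ((load w j).+1 == r.+1)%:R) = b by [].
have -> : urn_mean q' (fun w => (r < (load w j))%N%:R) = F by [].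
have -> : urn_mean q' (fun w => ((load w j) == r.+1)%:R) = b' by [].
have hp1 := ler_wpM2l (_ : 0 <= 1 - p) h1.
have hp2 := ler_wpM2l p0 h2.
have b1 : b <= 1 by lra.
(* The inductive hypothesis for [G] gives only the factor [r]; this further [p * b] raises it to
   [r.+1]. *)
have hb : p * (1 - p) * b ^+ 2 <= p * b.
  rewrite -mulrA ler_wpM2l// expr2 mulrA ler_piMl// mulr_ile1//; lra.
move: hp1; rewrite subr_ge0 => /(_ p1) hp1.
have -> : (F + p * (G - F)) * (1 - (F + p * (G - F))) =
  (1 - p) * (F * (1 - F)) + p * (G * (1 - G)) + p * (1 - p) * b ^+ 2.
  by rewrite (_ : b = G - F) ?GF; ring.
apply: le_trans (lerD (lerD hp1 hp2) hb) _.
by rewrite -natr1; lra.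
Qed.

(** The exponential factors over the urns into functions of single loads, all monotone in the same
    direction, so negative association applies and each factor is a centered Bernoulli moment
    generating function. *)
Lemma urn_mgf_le n (q : 'I_n -> K -> R) (D : pred K) r (x y : R) :
  stochastic q -> 0 <= x -> `|y| = 1 ->
  urn_mean q (fun w => expR (x * (y *
    (\sum_(j | D j) (r <= load w j)%N%:R - \sum_(j | D j) tail_prob q r j))))
  <= expR ((\sum_(j | D j) tail_prob q r j * (1 - tail_prob q r j)) *
           bennett_fun x).
Proof.
move=> hq x0 y1.
pose f j m := if D j then
   expR (x * (y * ((r <= m)%N%:R - tail_prob q r j))) else 1.
have -> : (fun w => expR (x * (y * (\sum_(j | D j) (r <= load w j)%N%:R -
    \sum_(j | D j) tail_prob q r j)))) =
    (fun w : {ffun 'I_n -> K} => \prod_j f j (load w j)).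
  apply/funext => w; rewrite -sumrB !mulr_sumr expR_sum.
  by rewrite big_mkcond/=; apply: eq_bigr => j _.
apply: le_trans (urn_mean_prod_le hq _ _) _.
- by move=> j m; rewrite /f; case: ifP => // _; exact: expR_ge0.
- have mm m : (r <= m)%N%:R <= (r <= m.+1)%N%:R :> R.
    by rewrite ler_nat; case: (leqP r m) => // rm; rewrite leqW.
  (* The sign of [y] decides whether all factors increase or all decrease with the load. *)
  have [y0|y0] := leP 0 y; [left|right] => j m; rewrite /f; case: ifP => // _;
    rewrite ler_expR ler_wpM2l//.
    by rewrite ler_wpM2l// lerB.
  by rewrite ler_wnM2l ?lerB// ltW.
- rewrite mulr_suml expR_sum [leRHS]big_mkcond/=; apply: ler_prod => j _.
  apply/andP; split.
    rewrite -(urn_mean_cst 0 hq); apply: le_urn_mean => // w.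
    by rewrite /f; case: ifP => // _; exact: expR_ge0.
  rewrite /f; case: ifP => _; last by rewrite urn_mean_cst.
  apply: le_trans (centered_bernoulli_mgf_le (tail_prob01 r j hq)
                    x0 y1).
  set t := tail_prob _ _ _; rewrite {3}/t /tail_prob.
  (* A function of an indicator is affine in it, so its mean follows by linearity. *)
  have -> : (fun w => expR (x * (y * ((r <= load w j)%N%:R - t)))) =
    (fun w : {ffun 'I_n -> K} => expR (x * (- (y * t))) +
      (expR (x * (y * (1 - t))) - expR (x * (- (y * t)))) *
        (r <= load w j)%N%:R).
    apply/funext => w; case: leq; rewrite /= ?mulr1 ?mulr0.
      by rewrite [RHS]addrC subrK.
    by rewrite sub0r mulrN addr0.
  rewrite urn_meanD urn_mean_cst// urn_meanZ -/(tail_prob q r j) -/t.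
  by lra.
Qed.

End finite_urns.

(** * Expectations of finitely valued variables, bounded convergence and the Chernoff bound *)

Section expectations.
Context d (T : measurableType d) (R : realType) (P : probability T R).

Lemma expectation_finite_range (K : finType) (X : T -> K) (G : K -> R) :
  (forall k, measurable [set t | X t = k]) -> (forall k, 0 <= G k) ->
  'E_P[fun t => G (X t)]%E = (\sum_k fine (P [set t | X t = k]) * G k)%:E.
Proof.
move=> mX G0; pose A k := [set t | X t = k].
have GE t : G (X t) = \sum_k G k * \1_(A k) t.
  rewrite (bigD1 (X t))//= indicE mem_set// mulr1 big1 ?addr0// => k kX.
  rewrite indicE memNset ?mulr0// => /= Xk; by rewrite Xk eqxx in kX.
rewrite unlock; under eq_integral do rewrite GE -sumEFin.
rewrite ge0_integral_sum//; first last.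
- by move=> k t _; rewrite lee_fin mulr_ge0.
- by move=> k; apply/measurable_EFinP; apply: measurable_funM => //;
    exact/measurable_indic/mX.
rewrite -sumEFin; apply: eq_bigr => k _.
under eq_integral do rewrite EFinM.
rewrite ge0_integralZl//; last by rewrite lee_fin.
- rewrite integral_indic ?setIT//; last exact: mX.
  rewrite EFinM fineK ?fin_num_measure//.
  by rewrite muleC.
- exact/measurable_EFinP/measurable_indic/mX.
Qed.

Lemma measurable_finite_range (K : finType) (X : T -> K) (G : K -> R) :
  (forall k, measurable [set t | X t = k]) ->
  measurable_fun setT (fun t => G (X t)).
Proof.
move=> mX; pose A k := [set t | X t = k].
have -> : (fun t => G (X t)) = (fun t => \sum_k G k * \1_(A k) t).
  apply/funext => t.
  rewrite (bigD1 (X t))//= indicE mem_set// mulr1 big1 ?addr0// => k kX.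
  rewrite indicE memNset ?mulr0// => /= Xk; by rewrite Xk eqxx in kX.
by apply: measurable_sum => k; apply: measurable_funM => //;
  exact/measurable_indic/mX.
Qed.

Lemma cvg_expectation_bounded (X : nat -> T -> R) (Y : T -> R) (C : R) :
  (forall m, measurable_fun setT (X m)) ->
  (forall m t, 0 <= X m t <= C) ->
  (forall t, X m t @[m --> \oo] --> Y t) ->
  'E_P[X m]%E @[m --> \oo] --> 'E_P[Y]%E.
Proof.
move=> mX XC XY; rewrite unlock.
have mY : measurable_fun setT Y by apply: (measurable_fun_cvg mX) => t _.
have [] := @dominated_convergence _ _ _ P setT measurableT
  (fun m t => (X m t)%:E) (fun t => (Y t)%:E) (cst C%:E).
- by move=> m; apply/measurable_EFinP.
- exact/measurable_EFinP.
- by apply: aeW => t _; apply: cvg_EFin; [exact: nearW|exact: XY].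
- exact: finite_measure_integrable_cst.
- apply: aeW => t m _; rewrite /= lee_fin; have /andP[X0 XC'] := XC m t.
  by rewrite ger0_norm.
- by [].
Qed.

Lemma chernoff_expR (Y : T -> R) (x a c : R) : measurable_fun setT Y ->
  0 < x -> ('E_P[fun t => expR (x * Y t)] <= (expR c)%:E)%E ->
  (P [set t | a <= Y t]%R <= (expR (c - x * a))%:E)%E.
Proof.
move=> mY x0 hc.
pose Z : {RV P >-> R} := mfun_Sub (mem_set mY : Y \in mfun).
have := chernoff Z a x0; rewrite /mmt_gen_fun => /le_trans; apply.
rewrite expRD EFinM; apply: lee_wpmul2r; first by rewrite lee_fin expR_ge0.
apply: le_trans hc; rewrite le_eqVlt; apply/orP; left; apply/eqP.
by congr ('E_P[_]%E); apply/funext => t /=; rewrite mulrC.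
Qed.

End expectations.

(** With [a = sqrt (2 s / w)], the choice [x = a / (1 + a / 3)] makes [1 - x / 3] the inverse of
    [1 + a / 3]; the Bernstein bound on [bennett_fun x] then yields exactly [- s]. *)
Lemma bernstein_parameter (R : realType) (w s : R) : 0 <= w -> 0 < s ->
  exists2 x, 0 < x &
    w * bennett_fun x - x * (Num.sqrt (2 * w * s) + s / 3) <= - s.
Proof.
move=> w0 s0; have [->|wn0] := eqVneq w 0.
  (* Only [- x * (s / 3)] survives when [w = 0], and [x = 3] turns it into [- s]. *)
  by exists 3 => //; rewrite mul0r mulr0 mul0r sqrtr0; lra.
have {w0 wn0} w0 : 0 < w by rewrite lt_neqAle eq_sym wn0.
pose y := Num.sqrt (2 * w * s).
have y0 : 0 < y by rewrite sqrtr_gt0 !mulr_gt0.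
have y2 : y ^+ 2 = 2 * w * s by rewrite sqr_sqrtr// ltW// !mulr_gt0.
rewrite -/y; pose a := y / w.
have a0 : 0 < a by rewrite divr_gt0.
have yE : y = a * w by rewrite /a divfK// gt_eqF.
have sE : s = a ^+ 2 * w / 2.
  apply: (mulfI (_ : 2 * w != 0)); first by rewrite mulf_neq0 ?gt_eqF.
  by rewrite -y2 yE; field.
pose x := a / (1 + a / 3).
have a3 : 0 < 1 + a / 3 by rewrite addr_gt0// divr_gt0.
exists x; first by rewrite divr_gt0.
have x0 : 0 <= x by rewrite divr_ge0// ltW.
have x3 : 1 - x / 3 = (1 + a / 3)^-1.
  by rewrite /x; field; rewrite ?gt_eqF//; lra.
have := bennett_fun_le_bernstein x0.
rewrite x3 -ler_pdivlMl ?invr_gt0// invrK => hb.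
have := ler_wpM2l (ltW w0) hb.
suff -> : w * ((1 + a / 3) * (x ^+ 2 / 2)) = x * (y + s / 3) - s by lra.
rewrite yE sE /x; field; lra.
Qed.

(** * Truncation to the symbols up to [N], seen as an urn scheme *)

Section truncation.
Context d (T : measurableType d) (R : realType) (P : probability T R).
Context (n : nat) (U : 'I_n -> {RV P >-> nat}).
Hypothesis indU : mutually_independent U.
Variable N : nat.

(* [inord] is the identity on [0 .. N] and sends all larger symbols to [0],
   which is never counted. *)
Definition cells (t : T) : {ffun 'I_n -> 'I_N.+1} := [ffun i => inord (U i t)].

Definition cell_prob (i : 'I_n) (k : 'I_N.+1) : R :=
  fine (P [set t | inord (U i t) = k]).

Lemma measurable_cell i (k : 'I_N.+1) :
  measurable [set t | inord (U i t) = k].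
Proof.
rewrite (_ : [set _ | _] = U i @^-1` [set m | inord m = k])//.
by rewrite -[X in measurable X]setTI; apply: measurable_funPT.
Qed.

Lemma cells_event (v : {ffun 'I_n -> 'I_N.+1}) : [set t | cells t = v] =
  \bigcap_(i in [set` [set: 'I_n]%SET]) (U i @^-1` [set m | inord m = v i]).
Proof.
apply/seteqP; split => t /=.
  by move=> <- i _ /=; rewrite ffunE.
by move=> h; apply/ffunP => i; rewrite ffunE; apply: h; rewrite /= inE.
Qed.

Lemma measurable_cells v : measurable [set t | cells t = v].
Proof.
rewrite cells_event; apply: fin_bigcap_measurable => // i _.
exact: measurable_cell.
Qed.

(** Independence enters here: it makes the law of [cells] the product law behind [urn_mean]. *)
Lemma cells_prob v : fine (P [set t | cells t = v]) = \prod_i cell_prob i (v i).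
Proof.
rewrite cells_event indU//.
rewrite (eq_big predT (fun i => (cell_prob i (v i))%:E)).
- by rewrite prodEFin.
- by move=> i; rewrite inE.
- move=> i _; rewrite /cell_prob fineK// fin_num_measure//.
  exact: measurable_cell.
Qed.

Lemma cell_prob_stochastic : stochastic cell_prob.
Proof.
move=> i; split; first by move=> k; apply: fine_ge0.
(* Total mass 1 is read off from the expectation of the constant 1. *)
have := expectation_finite_range P (measurable_cell i) (fun=> ler01).
rewrite expectation_cst => -[] /esym h.
by rewrite -[RHS]h; apply: eq_bigr => k _; rewrite mulr1.
Qed.

Lemma expectation_cells G : (forall v, 0 <= G v) ->
  'E_P[fun t => G (cells t)]%E = (urn_mean cell_prob G)%:E.
Proof.
move=> G0; rewrite (expectation_finite_range P measurable_cells)//.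
by congr EFin; apply: eq_bigr => v _; rewrite cells_prob.
Qed.

Lemma load_cells (j : 'I_N.+1) t : (0 < j)%N -> load (cells t) j = occ U j t.
Proof.
move=> j0; rewrite /load /occ; apply: eq_bigr => i _; rewrite ffunE.
congr nat_of_bool.
have [UN|NU] := ltnP (U i t) N.+1; first by rewrite -val_eqE /= inordK.
rewrite /inord /insubd insubN -?leqNgt//= -val_eqE/=.
by rewrite ltn_eqF// gtn_eqF// (leq_trans (ltn_ord j)).
Qed.

End truncation.

(** * Occupancy counts as limits of their truncations *)

Section occupancy_counts.
Context d (T : measurableType d) (R : realType) (P : probability T R).
Context (n : nat) (U : 'I_n -> {RV P >-> nat}).

Definition trunc_count (g : pred nat) (N : nat) (t : T) : R :=
  \sum_(1 <= j < N.+1) (g (occ U j t))%:R.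

(* Convertible to [occ_eq U r] for [g = pred1 r] and to [occ_ge U r] for
   [g = leq r]. *)
Definition occ_count (g : pred nat) (t : T) : R :=
  fine (\sum_(1 <= j <oo) ((g (occ U j t))%:R : R)%:E)%E.

Lemma trunc_countE g N : trunc_count g N = fun t =>
  \sum_(j < N.+1 | (0 < j)%N) (g (load (cells U N t) j))%:R.
Proof.
apply/funext => t; rewrite /trunc_count [RHS]big_mkcond [RHS]big_ord_recl/=.
rewrite add0r big_add1/= big_mkord.
by apply: eq_bigr => j _; rewrite load_cells.
Qed.

Lemma measurable_trunc_count g N : measurable_fun setT (trunc_count g N).
Proof.
rewrite trunc_countE.
apply: (measurable_finite_range (X := cells U N)
  (fun v => \sum_(j < N.+1 | (0 < j)%N) (g (load v j))%:R)).
exact: measurable_cells.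
Qed.

(** Symbols beyond every draw have occupancy 0, and [g 0 = false] removes their terms from the
    series. *)
Lemma occ_count_trunc g N t : g 0 = false -> (forall i, U i t <= N)%N ->
  occ_count g t = trunc_count g N t.
Proof.
move=> g0 UN; rewrite /occ_count.
suff -> : (\sum_(1 <= j <oo) ((g (occ U j t))%:R : R)%:E =
    (trunc_count g N t)%:E)%E by [].
apply: lim_near_cst => //; exists N.+1 => // M /= NM.
rewrite /trunc_count -sumEFin (big_cat_nat _ NM)//=.
rewrite [X in (_ + X)%E]big_nat_cond [X in (_ + X)%E]big1 ?adde0//.
move=> j /andP[/andP[Nj _] _].
rewrite /occ big1 ?g0// => i _; apply/eqP; rewrite eqb0.
by rewrite ltn_eqF// (leq_ltn_trans (UN i)).
Qed.

Lemma near_occ_count_trunc g t : g 0 = false ->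
  \forall N \near \oo, trunc_count g N t = occ_count g t.
Proof.
move=> g0; exists (\max_i U i t)%N => // N /= UN.
rewrite (occ_count_trunc (N := N))// => i; apply: leq_trans UN.
exact: leq_bigmax.
Qed.

Lemma cvg_trunc_count g t : g 0 = false ->
  trunc_count g N t @[N --> \oo] --> occ_count g t.
Proof. by move=> g0; apply: cvg_near_cst; exact: near_occ_count_trunc. Qed.

Lemma trunc_count_ge0 g N t : 0 <= trunc_count g N t.
Proof. exact: sumr_ge0. Qed.

(** A counted symbol is hit by at least one draw, and each draw hits one symbol. The bound is
    uniform in [N] and [t], as dominated convergence requires. *)
Lemma trunc_count_le g N t : g 0 = false -> trunc_count g N t <= n%:R.
Proof.
move=> g0; rewrite /trunc_count -natr_sum ler_nat.
apply: (@leq_trans (\sum_(1 <= j < N.+1) occ U j t)%N).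
  by apply: leq_sum => j _; case: (occ U j t) => [|m]; [rewrite g0|case: (g _)].
rewrite /occ exchange_big/= -[leqRHS]card_ord -sum1_card; apply: leq_sum => i _.
rewrite (_ : (\sum_(1 <= j < N.+1) (U i t == j))%N =
    count_mem (U i t) (index_iota 1 N.+1)).
  by rewrite count_uniq_mem ?iota_uniq// leq_b1.
rewrite -sum1_count [RHS]big_mkcond/=; apply: eq_bigr => j _.
by rewrite eq_sym; case: eqP.
Qed.

Lemma trunc_count_le_occ g N t : g 0 = false ->
  trunc_count g N t <= occ_count g t.
Proof.
move=> g0; have [M _ hM] := near_occ_count_trunc t g0.
have NM : (N.+1 <= (maxn M N).+1)%N by rewrite ltnS leq_maxr.
rewrite -(hM (maxn M N)) /=; last exact: leq_maxl.
rewrite /trunc_count (big_cat_nat _ NM)//= lerDl.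
exact: sumr_ge0.
Qed.

Lemma measurable_occ_count g : g 0 = false -> measurable_fun setT (occ_count g).
Proof.
move=> g0; apply: (measurable_fun_cvg (measurable_trunc_count g)) => t _.
exact: cvg_trunc_count.
Qed.

Lemma occ_count_ge0 g t : g 0 = false -> 0 <= occ_count g t.
Proof.
move=> g0; apply: le_trans (trunc_count_le_occ 0 t g0).
exact: trunc_count_ge0.
Qed.

Lemma occ_count_le g t : g 0 = false -> occ_count g t <= n%:R.
Proof.
move=> g0; have [N _ /(_ N (leqnn N)) <-] := near_occ_count_trunc t g0.
exact: trunc_count_le.
Qed.

Lemma expectation_fin_bounded (X : T -> R) (C : R) : measurable_fun setT X ->
  (forall t, 0 <= X t <= C) -> 'E_P[X]%E \is a fin_num.
Proof.
move=> mX XC; apply/fin_numPlt/andP; split.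
  apply: (lt_le_trans ltNy0); apply: expectation_ge0 => t.
  by have /andP[] := XC t.
apply: (@le_lt_trans _ _ C%:E); last exact: ltry.
rewrite -(expectation_cst P C); apply: expectation_le => //.
- by move=> t; have /andP[] := XC t.
- by move=> t; have /andP[/le_trans X0 /X0] := XC t.
- by apply: aeW => t; have /andP[] := XC t.
Qed.

Lemma expectation_occ_count_fin g : g 0 = false ->
  'E_P[occ_count g]%E \is a fin_num.
Proof.
move=> g0; apply: (@expectation_fin_bounded _ n%:R).
  exact: measurable_occ_count.
by move=> t; rewrite occ_count_ge0// occ_count_le.
Qed.

Lemma cvg_expectation_trunc_count g : g 0 = false ->
  'E_P[trunc_count g N]%E @[N --> \oo] --> 'E_P[occ_count g]%E.
Proof.
move=> g0; apply: (@cvg_expectation_bounded _ _ _ _ _ _ n%:R).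
- exact: measurable_trunc_count.
- by move=> m t; rewrite trunc_count_ge0 trunc_count_le.
- by move=> t; exact: cvg_trunc_count.
Qed.

Hypothesis indU : mutually_independent U.

Lemma expectation_trunc_count g N : 'E_P[trunc_count g N]%E =
  (\sum_(j < N.+1 | (0 < j)%N)
     urn_mean (cell_prob U (N := N)) (fun v => (g (load v j))%:R))%:E.
Proof.
rewrite trunc_countE.
rewrite (expectation_cells indU
  (G := fun v => \sum_(j < N.+1 | (0 < j)%N) (g (load v j))%:R)).
  by rewrite urn_mean_sum.
by move=> v; exact: sumr_ge0.
Qed.

(** Truncation only discards symbols, so the truncated means are bounded by a quantity independent
    of [N]. *)
Lemma urn_mean_sum_le g N : g 0 = false ->
  \sum_(j < N.+1 | (0 < j)%N)
    urn_mean (cell_prob U (N := N)) (fun v => (g (load v j))%:R) <=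
  fine 'E_P[occ_count g]%E.
Proof.
move=> g0; rewrite -lee_fin -expectation_trunc_count.
rewrite fineK ?expectation_occ_count_fin//; apply: expectation_le.
- exact: measurable_trunc_count.
- exact: measurable_occ_count.
- by move=> t; exact: trunc_count_ge0.
- by move=> t; exact: occ_count_ge0.
- by apply: aeW => t; exact: trunc_count_le_occ.
Qed.

(** * Bernstein's inequality for the number of symbols occurring at least [r] times *)

Section exponential_moments.
Variable r : nat.
Hypothesis r0 : (0 < r)%N.

Let Z : T -> R := occ_count (leq r).
Let m : R := fine 'E_P[Z]%E.
Let w : R := Num.min (r%:R * fine 'E_P[occ_count (pred1 r)]%E) m.

Let g0 : leq r 0 = false. Proof. by case: r r0. Qed.

Lemma sum_tail_prob_var_le N : \sum_(j < N.+1 | (0 < j)%N)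
  tail_prob (cell_prob U (N := N)) r j *
  (1 - tail_prob (cell_prob U (N := N)) r j) <= w.
Proof.
have hq := cell_prob_stochastic U N.
rewrite /w le_min; apply/andP; split.
  apply: (@le_trans _ _ (r%:R * \sum_(j < N.+1 | (0 < j)%N)
      point_prob (cell_prob U (N := N)) r j)).
    by rewrite mulr_sumr; apply: ler_sum => j _; exact: tail_prob_var_le.
  apply: ler_wpM2l => //.
  by apply: (urn_mean_sum_le (g := pred1 r)); case: r r0.
apply: le_trans (urn_mean_sum_le N g0); apply: ler_sum => j _.
have /andP[t0 t1] := tail_prob01 r j hq.
by rewrite -[leRHS]mulr1 -/(tail_prob _ r j) ler_wpM2l// gerBl.
Qed.

(** Limit of [urn_mgf_le] as [N] grows: the truncated counts and their means both converge, while
    the variance factor [w] does not depend on [N]. *)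
Lemma occ_ge_mgf_le (x y : R) : 0 <= x -> `|y| = 1 ->
  ('E_P[fun t => expR (x * (y * (Z t - m)))] <=
   (expR (w * bennett_fun x))%:E)%E.
Proof.
move=> x0 y1.
pose mN N := fine 'E_P[trunc_count (leq r) N]%E.
pose X N t := expR (x * (y * (trunc_count (leq r) N t - mN N))).
have mNE N : mN N = \sum_(j < N.+1 | (0 < j)%N)
    tail_prob (cell_prob U (N := N)) r j.
  by rewrite /mN expectation_trunc_count.
have mN01 N : 0 <= mN N <= n%:R.
  rewrite mNE; apply/andP; split.
    apply: sumr_ge0 => j _.
    by have /andP[] := tail_prob01 r j (cell_prob_stochastic U N).
  apply: le_trans (urn_mean_sum_le N g0) _.
  rewrite -lee_fin fineK ?expectation_occ_count_fin//.
  rewrite -(expectation_cst P n%:R); apply: expectation_le => //.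
  - exact: measurable_occ_count.
  - by move=> t; exact: occ_count_ge0.
  - by apply: aeW => t; exact: occ_count_le.
have XZ : 'E_P[X N]%E @[N --> \oo] -->
    'E_P[fun t => expR (x * (y * (Z t - m)))]%E.
  (* The count and its mean both lie between 0 and [n], so the exponent is at most [x * n%:R]. *)
  apply: (@cvg_expectation_bounded _ _ _ _ _ _ (expR (x * n%:R))).
  - move=> N; apply: measurableT_comp => //.
    apply: measurable_funM => //; apply: measurable_funM => //.
    by apply: measurable_funB => //; exact: measurable_trunc_count.
  - move=> N t; rewrite expR_ge0/= ler_expR ler_wpM2l//.
    apply: le_trans (ler_norm _) _; rewrite normrM y1 mul1r ler_norml.
    have := trunc_count_le N t g0; have := trunc_count_ge0 (leq r) N t.
    by have /andP[] := mN01 N; lra.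
  - move=> t.
    suff h : x * (y * (trunc_count (leq r) N t - mN N)) @[N --> \oo] -->
        x * (y * (Z t - m)).
      exact: (cvg_comp _ _ h (@continuous_expR R _)).
    apply: cvgM; first exact: cvg_cst.
    apply: cvgM; first exact: cvg_cst.
    apply: cvgB; first exact: cvg_trunc_count.
    apply: fine_cvg; rewrite fineK ?expectation_occ_count_fin//.
    exact: cvg_expectation_trunc_count.
rewrite -(cvg_lim _ XZ)//; apply: lime_le.
  by apply/cvg_ex; eexists; exact: XZ.
apply: nearW => N.
pose G (v : {ffun 'I_n -> 'I_N.+1}) := expR (x * (y *
  (\sum_(j < N.+1 | (0 < j)%N) (r <= load v j)%N%:R - mN N))).
have -> : X N = fun t => G (cells U N t) by rewrite /X trunc_countE.
rewrite (expectation_cells indU (G := G)); last by move=> v; exact: expR_ge0.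
rewrite /G lee_fin mNE.
apply: le_trans (urn_mgf_le _ _ (cell_prob_stochastic U N) x0 y1) _.
by rewrite ler_expR ler_wpM2r ?bennett_fun_ge0// sum_tail_prob_var_le.
Qed.

(** Chernoff's bound for [y = 1] and [y = -1], then a union bound, whence the factor 2. The free
    [w'] lets the levels [r] and [r.+1] share one threshold. *)
Lemma occ_ge_tail (s w' : R) : 0 < s -> 0 <= w' -> w <= w' ->
  (P [set t | Num.sqrt (2 * w' * s) + s / 3 <= `|Z t - m| ]%R <=
   (2 * expR (- s))%:E)%E.
Proof.
move=> s0 w'0 ww'; have [x x0 hx] := bernstein_parameter w'0 s0.
set a := Num.sqrt _ + _ in hx *.
have mZ : measurable_fun setT Z by exact: measurable_occ_count.
have mY y : measurable_fun setT (fun t => y * (Z t - m)).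
  by apply: measurable_funM => //; apply: measurable_funB.
have one_sided y : `|y| = 1 ->
    (P [set t | a <= y * (Z t - m)]%R <= (expR (- s))%:E)%E.
  move=> y1; apply: (le_trans (chernoff_expR a (mY y) x0
    (occ_ge_mgf_le (ltW x0) y1))).
  rewrite lee_fin ler_expR; apply: le_trans hx; rewrite lerB//.
  by rewrite ler_wpM2r// bennett_fun_ge0.
have mS y : measurable [set t | a <= y * (Z t - m)]%R.
  by rewrite -[X in measurable X]setTI; exact: measurable_fun_le.
rewrite (_ : [set _ | _] =
  [set t | a <= 1 * (Z t - m)]%R `|`
  [set t | a <= -1 * (Z t - m)]%R); last first.
  apply/seteqP; split => t /=; rewrite mul1r mulN1r ler_normr.
    by move=> /orP.
  by move/orP.
apply: (le_trans (measureU2 _ (mS _) (mS _))).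
rewrite mulrDl mul1r EFinD; apply: leeD; apply: one_sided.
  by rewrite normr1.
by rewrite normrN1.
Qed.

End exponential_moments.

End occupancy_counts.

(** * Splitting the exact count into two tail counts, and conclusion *)

Lemma occ_ge_split d (T : measurableType d) (R : realType) (P : probability T R)
    (n : nat) (U : 'I_n -> {RV P >-> nat}) r t : (0 < r)%N ->
  occ_ge U r t = occ_eq U r t + occ_ge U r.+1 t :> R.
Proof.
move=> r0; have UN i : (U i t <= \max_i U i t)%N by exact: leq_bigmax.
have hge q : (0 < q)%N ->
    occ_ge U q t = trunc_count U (leq q) (\max_i U i t) t :> R.
  by move=> q0; apply: (occ_count_trunc (g := leq q)) => //; case: q q0.
have heq : occ_eq U r t = trunc_count U (pred1 r) (\max_i U i t) t :> R.
  by apply: (occ_count_trunc (g := pred1 r)) => //; case: r r0.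
rewrite !hge// heq.
rewrite /trunc_count -big_split/=; apply: eq_bigr => j _.
by case: (ltngtP r (occ U j t)); rewrite ?addr0 ?add0r.
Qed.

Lemma expectation_occ_ge_split d (T : measurableType d) (R : realType)
    (P : probability T R) (n : nat) (U : 'I_n -> {RV P >-> nat}) r :
  (0 < r)%N -> fine 'E_P[occ_ge U r]%E =
    fine 'E_P[occ_eq U r]%E + fine 'E_P[occ_ge U r.+1]%E.
Proof.
move=> r0.
have [ge0r eq0r] : leq r 0 = false /\ pred1 r 0 = false by case: r r0.
have fin g := @expectation_occ_count_fin _ _ _ _ _ U g.
rewrite -fineD; [|exact: (fin (pred1 r))|exact: (fin (leq r.+1))].
congr fine; rewrite unlock -ge0_integralD//.
- by apply: eq_integral => t _; rewrite occ_ge_split.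
- by move=> t _; rewrite lee_fin; exact: (@occ_count_ge0 _ _ _ _ _ U (pred1 r)).
- apply/measurable_EFinP; exact: (@measurable_occ_count _ _ _ _ _ U (pred1 r)).
- move=> t _; rewrite lee_fin.
  exact: (@occ_count_ge0 _ _ _ _ _ U (leq r.+1)).
- apply/measurable_EFinP; exact: (@measurable_occ_count _ _ _ _ _ U (leq r.+1)).
Qed.

Unset Implicit Arguments.
Set Strict Implicit.

Theorem proposition3p5 (d : measure_display) (T : measurableType d)
    (R : realType) (P : probability T R) (p : nat -> R)
    (n : nat) (U : 'I_n -> {RV P >-> nat}) (r : nat) (s : R)
    (hp : is_pmf_pos p)
    (hU : forall i : 'I_n, has_pmf_pos (U i) p)
    (hind : mutually_independent U)
    (hn : (1 <= n)%N) (hr : (1 <= r)%N) (hs : 0 <= s) :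
  (P [set w | Num.sqrt (4 * var_proxy U r * s) + 2 * s / 3 <=
               `|occ_eq U r w - fine 'E_P[occ_eq U r]| ]%R
   <= (4 * expR (- s))%:E)%E.

Proof.
have mge q : (0 < q)%N -> measurable_fun setT (occ_ge U q : T -> R).
  by move=> q0; apply: (@measurable_occ_count _ _ _ _ _ U (leq q)); case: q q0.
have meq : measurable_fun setT (occ_eq U r : T -> R).
  by apply: (@measurable_occ_count _ _ _ _ _ U (pred1 r)); case: (r) hr.
have mdev (Z : T -> R) (a m : R) : measurable_fun setT Z ->
    measurable [set w | a <= `|Z w - m|]%R.
  move=> mZ; rewrite -[X in measurable X]setTI; apply: measurable_fun_le => //.
  by apply: measurableT_comp => //; apply: measurable_funB.
(* At [s = 0] the right-hand side is at least 1; the Bernstein parameter exists only for positive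
   [s]. *)
have [s0|s0] := leP s 0.
  apply: (le_trans (probability_le1 _ (mdev _ _ _ meq))).
  rewrite lee_fin; have : 1 <= expR (- s) by rewrite -expR0 ler_expR oppr_ge0.
  lra.
pose v := Num.min (Num.max (r%:R * fine 'E_P[occ_eq U r]%E)
  (r.+1%:R * fine 'E_P[occ_eq U r.+1]%E)) (fine 'E_P[occ_ge U r]%E).
pose a := Num.sqrt (2 * v * s) + s / 3.
have E0 (X : T -> R) : (forall t, 0 <= X t) -> 0 <= fine 'E_P[X]%E.
  by move=> X0; apply: fine_ge0; exact: expectation_ge0.
have eq_ge0 t : 0 <= (occ_eq U r t : R).
  by apply: (@occ_count_ge0 _ _ _ _ _ U (pred1 r)); case: (r) hr.
have ge_ge0 t : 0 <= (occ_ge U r t : R).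
  by apply: (@occ_count_ge0 _ _ _ _ _ U (leq r)); case: (r) hr.
have Esplit := expectation_occ_ge_split U hr.
have v0 : 0 <= v by rewrite le_min le_max mulr_ge0 ?E0.
(* Since [var_proxy U r] is [2 * v], the threshold is twice the Bernstein threshold [a] for variance
   factor [v]. *)
have aE : Num.sqrt (4 * var_proxy U r * s) + 2 * s / 3 = 2 * a.
  rewrite /a /var_proxy -/v.
  have -> : 4 * (2 * v) * s = 2 ^+ 2 * (2 * v * s) by ring.
  by rewrite sqrtrM ?sqr_ge0// sqrtr_sqr ger0_norm//; lra.
rewrite aE.
have tail_r := @occ_ge_tail _ _ _ _ _ U hind r hr s v s0 v0.
have tail_r1 := @occ_ge_tail _ _ _ _ _ U hind r.+1 isT s v s0 v0.
pose D q := [set t | a <= `|occ_ge U q t - fine 'E_P[occ_ge U q]%E|]%R.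
(* A difference of two deviations can reach [2 * a] only if one of them reaches [a] in absolute
   value. *)
apply: (@le_trans _ _ (P (D r `|` D r.+1))).
  apply: le_measure; rewrite ?inE.
  - exact: mdev.
  - by apply: measurableU; apply: mdev; exact: mge.
  - move=> t /= ht; apply/orP; rewrite -[_ || _]negbK negb_or -!ltNge.
    apply/negP => /andP[h1 h2]; move: ht; apply/negP; rewrite -ltNge.
    have -> : occ_eq U r t - fine 'E_P[occ_eq U r]%E =
        (occ_ge U r t - fine 'E_P[occ_ge U r]%E) -
        (occ_ge U r.+1 t - fine 'E_P[occ_ge U r.+1]%E).
      by rewrite Esplit (occ_ge_split U t hr); ring.
    apply: le_lt_trans (ler_normB _ _) _; lra.
apply: (le_trans (measureU2 _ _ _)); [by apply: mdev; exact: mge..|].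
have -> : 4 * expR (- s) = 2 * expR (- s) + 2 * expR (- s) by ring.
rewrite EFinD; apply: leeD.
  apply: tail_r; rewrite /v le_min; apply/andP; split.
    by rewrite le_max ge_min lexx.
  by rewrite ge_min lexx orbT.
apply: tail_r1; rewrite /v le_min; apply/andP; split.
  by rewrite le_max !ge_min lexx orbT.
(* The factor at level [r.+1] is at most the mean of [occ_ge U r.+1], which [Esplit] bounds by that
   of [occ_ge U r]. *)
rewrite ge_min; apply/orP; right.
by rewrite [leRHS]Esplit lerDr E0.
Qed.
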